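(* Let $p$ be a prime. For $x\in p\mathbb{Z}_p$ let $\tau(x)=\inf\{s\ge0:\ \sum_{n\ge1}a_n(x)^{-s}<\infty\}$ be the convergence exponent of the digit sequence, and for $0\le\alpha\le\infty$ let $T(\alpha)=\{x\in p\mathbb{Z}_p:\ \tau(x)=\alpha\}$. Then $\dim_{\rm H}T(\infty)=1$ and $\dim_{\rm H}T(\alpha)=0$ for every $0\le\alpha<\infty$.
   Context: $\mathbb{Q}_p$ is the field of $p$-adic numbers with absolute value $|x|_p=p^{-v_p(x)}$, $\mathbb{Z}_p=\{x:|x|_p\le1\}$, $p\mathbb{Z}_p$ its maximal ideal. Schneider's $p$-adic continued fraction map $T_p:p\mathbb{Z}_p\to p\mathbb{Z}_p$ is $T_p(0)=0$ and $T_p(x)=p^{a_1(x)}/x-b_1(x)$ for $x\neq0$, where $a_1(x)=v_p(x)$ and $b_1(x)\in\{1,\dots,p-1\}$ satisfies $p^{a_1(x)}/x\equiv b_1(x)\pmod p$. For $n\ge2$, $a_n(x)=a_1(T_p^{n-1}(x))$, $b_n(x)=b_1(T_p^{n-1}(x))$. Hausdorff dimension is with respect to the metric $|x-y|_p$; $\inf\emptyset=\infty$. *)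

(* Defs.v *)
From HB Require Import structures.
From mathcomp Require Import all_boot all_order all_algebra.
From mathcomp Require Import generic_quotient fraction cyclic.
From mathcomp Require Import all_classical all_reals all_analysis.

Set Implicit Arguments.
Unset Strict Implicit.
Unset Printing Implicit Defensive.

Import Order.TTheory GRing.Theory Num.Theory.

Local Open Scope classical_set_scope.
Local Open Scope ring_scope.

(* An element of the inverse limit of the rings Z/p^n is stored as the sequence
   of its representatives in [0, p^n[. *)
Definition coherent (p : nat) (f : nat -> nat) : bool :=
  `[< forall n, f n = (f n.+1 %% p ^ n)%N >].

Record padic_int (p : nat) (p_pr : prime p) := PadicInt {
  residue :> nat -> nat;
  _ : coherent p residue }.

HB.instance Definition _ p (p_pr : prime p) :=
  [isSub for @residue p p_pr].
HB.instance Definition _ p (p_pr : prime p) :=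
  [Choice of padic_int p_pr by <:].

Section PadicIntRing.
Variables (p : nat) (p_pr : prime p).
Local Notation Z := (padic_int p_pr).
Implicit Types x y z : Z.

Lemma residueS x n : (x n.+1 %% p ^ n)%N = x n.
Proof. by case: x => f fP /=; move/asboolP: fP => /(_ n). Qed.

Lemma residue_mod x n : (x n %% p ^ n)%N = x n.
Proof. by rewrite -(residueS x n) modn_mod. Qed.

Lemma residue_modD x n m : (x (n + m) %% p ^ n)%N = x n.
Proof.
elim: m => [|m IH]; first by rewrite addn0 residue_mod.
by rewrite addnS -[RHS]IH -(residueS x (n + m)) modn_dvdm// dvdn_exp2l ?leq_addr.
Qed.

Lemma residue0 x : x 0%N = 0%N.
Proof. by rewrite -residue_mod expn0 modn1. Qed.

Lemma padic_intP x y : (forall n, x n = y n) -> x = y.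
Proof. by move=> xy; apply/val_inj/funext. Qed.

Fact padic_int_subproof (f : nat -> nat) :
  (forall n, f n = f n.+1 %[mod p ^ n]) -> coherent p (fun n => f n %% p ^ n)%N.
Proof.
move=> fP; apply/asboolP => n.
by rewrite modn_dvdm ?fP// dvdn_exp2l.
Qed.

Definition mk_padic_int f fP : Z := PadicInt p_pr (@padic_int_subproof f fP).

Fact zero_subproof n : 0 = 0 %[mod p ^ n]. Proof. by []. Qed.
Fact one_subproof n : 1 = 1 %[mod p ^ n]. Proof. by []. Qed.
Fact add_subproof x y n : (x n + y n = x n.+1 + y n.+1 %[mod p ^ n])%N.
Proof. by rewrite -(residueS x) -(residueS y) modnDm. Qed.
Fact mul_subproof x y n : (x n * y n = x n.+1 * y n.+1 %[mod p ^ n])%N.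
Proof. by rewrite -(residueS x) -(residueS y) modnMm. Qed.
Fact opp_subproof x n :
  ((p ^ n - x n)%N = (p ^ n.+1 - x n.+1)%N %[mod p ^ n])%N.
Proof.
have le_x m : (x m <= p ^ m)%N.
  by rewrite -residue_mod ltnW// ltn_pmod// expn_gt0 prime_gt0.
apply/eqP; rewrite -(eqn_modDr (x n.+1)) subnK// -modnDmr residueS subnK//.
by rewrite modnn expnS modnMl.
Qed.

Definition padic_zero := mk_padic_int zero_subproof.
Definition padic_one := mk_padic_int one_subproof.
Definition padic_opp x := mk_padic_int (opp_subproof x).
Definition padic_add x y := mk_padic_int (add_subproof x y).
Definition padic_mul x y := mk_padic_int (mul_subproof x y).

Fact padic_addA : associative padic_add.
Proof. by move=> x y z; apply: padic_intP => n /=; rewrite modnDmr modnDml addnA. Qed.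
Fact padic_addC : commutative padic_add.
Proof. by move=> x y; apply: padic_intP => n /=; rewrite addnC. Qed.
Fact padic_add0 : left_id padic_zero padic_add.
Proof. by move=> x; apply: padic_intP => n /=; rewrite modnDml residue_mod. Qed.
Fact padic_addN : left_inverse padic_zero padic_opp padic_add.
Proof.
move=> x; apply: padic_intP => n /=; rewrite modnDml subnK ?modnn ?mod0n//.
by rewrite -residue_mod ltnW// ltn_pmod// expn_gt0 prime_gt0.
Qed.
HB.instance Definition _ := GRing.isZmodule.Build Z
  padic_addA padic_addC padic_add0 padic_addN.

Fact padic_mulA : associative padic_mul.
Proof. by move=> x y z; apply: padic_intP => n /=; rewrite modnMmr modnMml mulnA. Qed.
Fact padic_mulC : commutative padic_mul.
Proof. by move=> x y; apply: padic_intP => n /=; rewrite mulnC. Qed.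
Fact padic_mul1 : left_id padic_one padic_mul.
Proof. by move=> x; apply: padic_intP => n /=; rewrite modnMml mul1n residue_mod. Qed.
Fact padic_mulD : left_distributive padic_mul padic_add.
Proof.
by move=> x y z; apply: padic_intP => n /=; rewrite modnMml modnDm mulnDl.
Qed.
Fact padic_1neq0 : padic_one != 0.
Proof.
apply/eqP => /(congr1 (fun x : Z => x 1%N)) /=.
by rewrite mod0n expn1 modn_small ?prime_gt1.
Qed.
HB.instance Definition _ := GRing.Zmodule_isComNzRing.Build Z
  padic_mulA padic_mulC padic_mul1 padic_mulD padic_1neq0.

Lemma residueD x y n : (x + y) n = ((x n + y n) %% p ^ n)%N.
Proof. by []. Qed.
Lemma residueM x y n : (x * y) n = ((x n * y n) %% p ^ n)%N.
Proof. by []. Qed.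
Lemma residue_nat k n : (k%:R : Z) n = (k %% p ^ n)%N.
Proof.
elim: k => [|k IH]; first by rewrite mod0n /= mod0n.
by rewrite mulrS residueD IH modnDm.
Qed.

Lemma residue_subn x n : (x - (x n)%:R) n = 0%N.
Proof.
set y := (_ - _); have : (y + (x n)%:R) n = x n by rewrite subrK.
rewrite residueD residue_nat modnDmr -[in RHS](residue_mod x n) => /eqP.
by rewrite -[X in _ == X %[mod _]]add0n eqn_modDr mod0n residue_mod => /eqP.
Qed.

Definition padic_unit : pred Z := fun x => `[< exists y, y * x = 1 >].
Definition padic_inv x : Z :=
  if pselect (exists y, y * x = 1) is left e then projT1 (cid e) else x.
Fact padic_mulV : {in padic_unit, left_inverse 1 padic_inv *%R}.
Proof.
move=> x /asboolP ex; rewrite /padic_inv; case: pselect => // e.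
exact: (projT2 (cid e)).
Qed.
Fact padic_unitP x y : y * x = 1 -> padic_unit x.
Proof. by move=> yx; apply/asboolP; exists y. Qed.
Fact padic_inv_out : {in [predC padic_unit], padic_inv =1 id}.
Proof.
move=> x /negP xU; rewrite /padic_inv; case: pselect => // e.
by case: xU; apply/asboolP.
Qed.
HB.instance Definition _ := GRing.ComNzRing_hasMulInverse.Build Z
  padic_mulV padic_unitP padic_inv_out.

Lemma padic_unitE x : (x \is a GRing.unit) = (x 1%N != 0%N).
Proof.
apply/idP/idP.
  move=> /mulVr /(congr1 (fun x : Z => x 1%N)).
  rewrite residueM (residue_nat 1) expn1 (modn_small (prime_gt1 p_pr)).
  by case: eqP => // ->; rewrite muln0 mod0n.
move=> x1; have cop n : coprime (x n) (p ^ n).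
  case: n => [|n]; first by rewrite expn0 coprimen1.
  rewrite coprime_pexpr// coprime_sym prime_coprime//.
  have := residue_modD x 1 n; rewrite add1n expn1 => xn1.
  by rewrite /dvdn xn1.
pose f n := (x n ^ (totient (p ^ n)).-1)%N.
have fx n : (f n * x n = 1 %[mod p ^ n])%N.
  rewrite /f mulnC -expnS prednK; first exact: Euler_exp_totient.
  by rewrite totient_gt0 expn_gt0 prime_gt0.
have fP n : f n = f n.+1 %[mod p ^ n].
  have fx1 : (f n.+1 * x n = 1 %[mod p ^ n])%N.
    rewrite -(residueS x n) modnMmr -(@modn_dvdm (p ^ n.+1)%N) ?dvdn_exp2l//.
    by rewrite fx modn_dvdm// dvdn_exp2l.
  rewrite -[in LHS](mul1n (f n)) -modnMml -fx1 modnMml -mulnA.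
  by rewrite -modnMmr [(x n * _)%N]mulnC fx modnMmr muln1.
apply/unitrPr; exists (mk_padic_int fP); rewrite mulrC.
apply: padic_intP => n; rewrite residueM (residue_nat 1) /= modnMml.
exact: fx.
Qed.

Lemma padic_divX x m : x m = 0%N -> exists y, x = p%:R ^+ m * y /\
  y 1%N = (x m.+1 %/ p ^ m)%N.
Proof.
move=> xm0; have pm0 : (0 < p ^ m)%N by rewrite expn_gt0 prime_gt0.
pose f k := (x (k + m) %/ p ^ m)%N.
have fP k : f k = f k.+1 %[mod p ^ k].
  by rewrite /f !modn_divl -expnD residue_mod addSn residueS.
exists (mk_padic_int fP); split.
  apply: padic_intP => n; rewrite -natrX residueM residue_nat /= modnMm /f.
  rewrite mulnC divnK; first by rewrite residue_modD.
  by rewrite /dvdn addnC residue_modD xm0.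
rewrite /= /f add1n modn_divl -expnD add1n residue_mod//.
Qed.

Lemma padic_decomp x : x != 0 ->
  exists m (u : Z), u \is a GRing.unit /\ x = p%:R ^+ m * u.
Proof.
move=> x0; have ex : exists n, x n != 0%N.
  apply: contrapT => /forallNP h; move/eqP: x0; apply; apply: padic_intP => n.
  by rewrite (residue_nat 0) mod0n; apply/eqP/negPn/negP/h.
case: (ex_minnP ex) => -[|m]; first by rewrite residue0.
move=> xm1 min; have xm0 : x m = 0%N.
  by apply/eqP/negPn/negP => /min; rewrite ltnn.
have [u [xE u1]] := padic_divX xm0; exists m, u; split=> //.
rewrite padic_unitE u1; apply: contra_neq xm1 => q0.
by rewrite (divn_eq (x m.+1) (p ^ m)) q0 mul0n add0n residueS.
Qed.

Lemma padic_pX_neq0 m : p%:R ^+ m != 0 :> Z.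
Proof.
apply/eqP => /(congr1 (fun x : Z => x m.+1)).
rewrite -natrX residue_nat (residue_nat 0) mod0n modn_small.
  by apply/eqP; rewrite -lt0n expn_gt0 prime_gt0.
by rewrite ltn_exp2l// prime_gt1.
Qed.

Fact padic_idomain : GRing.integral_domain_axiom Z.
Proof.
move=> x y xy0; apply/norP => -[/padic_decomp[a [u [uU xE]]]].
move=> /padic_decomp[b [v [vU yE]]].
have : p%:R ^+ (a + b) * (u * v) = 0 :> Z by rewrite exprD mulrACA -xE -yE.
move/(congr1 (fun z => z * (u * v)^-1)); rewrite mul0r mulrK ?unitrM ?uU//.
exact/eqP/padic_pX_neq0.
Qed.
HB.instance Definition _ :=
  GRing.ComUnitRing_isIntegral.Build Z padic_idomain.

End PadicIntRing.

Lemma frac_numden (D : idomainType) (x : {fraction D}) :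
  exists u v : D, v != 0 /\ x = tofrac u / tofrac v.
Proof.
exists (repr x).1, (repr x).2; split; first exact: denom_ratioP.
suff <- : x * tofrac (repr x).2 = tofrac (repr x).1.
  by rewrite mulfK// tofrac_eq0 denom_ratioP.
rewrite -{1}[x]reprK; move: (repr x) => r; unlock tofrac.
rewrite -[LHS]FracField.pi_mul; apply/eqmodP.
rewrite /= FracField.equivfE /FracField.mulf.
by rewrite !numden_Ratio ?(oner_eq0, mulf_neq0, denom_ratioP)//
  !mulr1 mulrC.
Qed.

(* The absolute value takes values in R, so R is recorded in the type in order
   to make it a metricType R. *)
Definition padic (R : realType) (p : nat) (p_pr : prime p) : Type :=
  {fraction (padic_int p_pr)}.

HB.instance Definition _ (R : realType) p (p_pr : prime p) :=
  GRing.Field.on (padic R p_pr).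

Section Padic.
Variables (R : realType) (p : nat) (p_pr : prime p).
Local Notation Z := (padic_int p_pr).
Local Notation Q := (padic R p_pr).
Implicit Types (x y : Q) (u : Z).

Definition of_padic_int u : Q := tofrac u.

HB.instance Definition _ := GRing.RMorphism.copy of_padic_int
  (@tofrac Z : {rmorphism Z -> {fraction Z}}).

(* The integer k such that x = p^k u for a p-adic unit u; the value at 0 is
   irrelevant. *)
Definition padic_val x : int :=
  xget 0 [set k | exists2 u, u \is a GRing.unit &
                  x = p%:R ^ k * of_padic_int u].

Definition padic_norm x : R :=
  if x == 0 then 0 else p%:R ^ (- padic_val x).

Definition padic_dist x y : R := padic_norm (x - y).

Lemma of_padic_int_eq0 u : (of_padic_int u == 0) = (u == 0).
Proof. exact: tofrac_eq0. Qed.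

Lemma of_padic_int_inj : injective of_padic_int.
Proof. by move=> u v /eqP; rewrite /of_padic_int tofrac_eq => /eqP. Qed.

Lemma padic_p_neq0 : p%:R != 0 :> Q.
Proof.
rewrite -(rmorph_nat of_padic_int) of_padic_int_eq0.
by have := padic_pX_neq0 p_pr 1; rewrite expr1.
Qed.

Lemma padic_fracE x : exists u v : Z,
  v != 0 /\ x = of_padic_int u / of_padic_int v.
Proof.
exact: frac_numden.
Qed.

Lemma padic_decompQ x : x != 0 -> exists k u,
  u \is a GRing.unit /\ x = p%:R ^ k * of_padic_int u.
Proof.
have [u [v [v0 ->]]] := padic_fracE x.
rewrite mulf_eq0 invr_eq0 !of_padic_int_eq0 negb_or => /andP[u0 _].
have [m [u' [u'U ->]]] := padic_decomp u0.
have [n [v' [v'U ->]]] := padic_decomp v0.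
exists (m%:Z - n%:Z), (u' / v'); rewrite unitrM u'U unitrV v'U; split=> //.
rewrite !rmorphM rmorphV// !rmorphXn !rmorph_nat expfzDr ?padic_p_neq0//.
by rewrite invfM mulrACA -exprnN.
Qed.

Lemma padic_int_dvd_nonunit (n : nat) u v : (0 < n)%N ->
  u = p%:R ^+ n * v -> u \isn't a GRing.unit.
Proof.
case: n => // n _ ->; rewrite padic_unitE negbK exprS -mulrA.
by rewrite residueM residue_nat expn1 modnn mul0n mod0n.
Qed.

Lemma padic_valE k u : u \is a GRing.unit ->
  padic_val (p%:R ^ k * of_padic_int u) = k.
Proof.
have wlog_lt (k1 k2 : int) (u1 u2 : Z) :
    p%:R ^ k1 * of_padic_int u1 = p%:R ^ k2 * of_padic_int u2 ->
    k1 < k2 -> u1 \isn't a GRing.unit.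
  move=> E lt12; apply: (@padic_int_dvd_nonunit `|k2 - k1|%N _ u2).
    by rewrite absz_gt0 subr_eq0 gt_eqF.
  apply: of_padic_int_inj.
  rewrite rmorphM rmorphXn rmorph_nat exprnP gez0_abs ?subr_ge0 ?ltW//.
  apply: (mulfI (expfz_neq0 k1 padic_p_neq0)).
  by rewrite E mulrA -expfzDr ?padic_p_neq0// subrKC.
move=> uU; rewrite /padic_val; case: xgetP => [l _ [v vU E]|/(_ k)]; last first.
  by case; exists u.
case: (ltgtP l k) => // lk.
  by have := wlog_lt _ _ _ _ (esym E) lk; rewrite vU.
by have := wlog_lt _ _ _ _ E lk; rewrite uU.
Qed.

Lemma padic_normE k u : u \is a GRing.unit ->
  padic_norm (p%:R ^ k * of_padic_int u) = p%:R ^ (- k).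
Proof.
move=> uU; rewrite /padic_norm padic_valE// mulf_eq0 expfz_eq0.
rewrite (negPf padic_p_neq0) andbF of_padic_int_eq0 /=.
by case: eqP uU => // ->; rewrite unitr0.
Qed.

Let p_gt0 : 0 < p%:R :> R. Proof. by rewrite ltr0n prime_gt0. Qed.
Let p_gt1 : 1 < p%:R :> R. Proof. by rewrite ltr1n prime_gt1. Qed.

Lemma padic_norm0 : padic_norm 0 = 0.
Proof. by rewrite /padic_norm eqxx. Qed.

Lemma padic_norm_ge0 x : 0 <= padic_norm x.
Proof. by rewrite /padic_norm; case: ifP => // _; apply/exprz_ge0/ltW. Qed.

Lemma padic_norm_eq0 x : padic_norm x = 0 -> x = 0.
Proof.
rewrite /padic_norm; case: eqP => // _ /eqP.
by rewrite expfz_eq0 (gt_eqF p_gt0) andbF.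
Qed.

Lemma padic_normN x : padic_norm (- x) = padic_norm x.
Proof.
have [->|/padic_decompQ[k [u [uU ->]]]] := eqVneq x 0; first by rewrite oppr0.
by rewrite -mulrN -rmorphN !padic_normE// unitrN.
Qed.

Lemma padic_norm_int u : padic_norm (of_padic_int u) <= 1.
Proof.
have [->|/padic_decomp[m [v [vU ->]]]] := eqVneq u 0.
  by rewrite rmorph0 padic_norm0.
rewrite rmorphM rmorphXn rmorph_nat exprnP padic_normE// -exprnN.
by rewrite invf_le1 ?exprn_gt0// exprn_ege1// ltW.
Qed.

Lemma padic_normM x y : padic_norm (x * y) = padic_norm x * padic_norm y.
Proof.
have [->|/padic_decompQ[k [u [uU ->]]]] := eqVneq x 0.
  by rewrite mul0r padic_norm0 mul0r.
have [->|/padic_decompQ[l [v [vU ->]]]] := eqVneq y 0.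
  by rewrite mulr0 padic_norm0 mulr0.
rewrite mulrACA -expfzDr ?padic_p_neq0// -rmorphM !padic_normE ?unitrM ?uU//.
by rewrite opprD expfzDr ?(gt_eqF p_gt0).
Qed.

Lemma padic_normD x y :
  padic_norm (x + y) <= Num.max (padic_norm x) (padic_norm y).
Proof.
have [->|] := eqVneq x 0; first by rewrite add0r le_max lexx orbT.
have [->|] := eqVneq y 0; first by rewrite addr0 le_max lexx.
move=> /padic_decompQ[l [v [vU ->]]] /padic_decompQ[k [u [uU ->]]].
wlog kl : k l u v uU vU / k <= l.
  move=> H; case: (leP k l) => kl; first exact: H.
  by rewrite addrC maxC; apply/H => //; apply: ltW.
rewrite le_max; apply/orP; left.
have -> : p%:R ^ l = p%:R ^ k * of_padic_int (p%:R ^+ `|l - k|%N).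
  rewrite rmorphXn rmorph_nat exprnP gez0_abs ?subr_ge0//.
  by rewrite -expfzDr ?padic_p_neq0// subrKC.
rewrite -mulrA -rmorphM -mulrDr -rmorphD padic_normM padic_normE//.
rewrite -[p%:R ^ k]mulr1 -(rmorph1 of_padic_int) padic_normE ?unitr1//.
by rewrite ler_piMr ?padic_norm_int// exprz_ge0// ltW.
Qed.

Lemma padic_distxx x : padic_dist x x = 0.
Proof. by rewrite /padic_dist subrr padic_norm0. Qed.

Lemma padic_dist_eq0 x y : padic_dist x y = 0 -> x = y.
Proof. by move/padic_norm_eq0/eqP; rewrite subr_eq0 => /eqP. Qed.

Lemma padic_dist_sym x y : padic_dist x y = padic_dist y x.
Proof. by rewrite /padic_dist -padic_normN opprB. Qed.

Lemma padic_dist_triangle y x z :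
  padic_dist x z <= padic_dist x y + padic_dist y z.
Proof.
rewrite /padic_dist -[x - z](subrKA y); apply: (le_trans (padic_normD _ _)).
by rewrite ge_max lerDl lerDr !padic_norm_ge0.
Qed.

HB.instance Definition _ := isMetric.Build R Q
  padic_distxx padic_dist_eq0 padic_dist_sym padic_dist_triangle.

End Padic.

Section SchneiderMap.
Variables (R : realType) (p : nat) (p_pr : prime p).
Local Notation Q := (padic R p_pr).
Implicit Types x : Q.

Definition Zp : set Q := [set x | padic_norm x <= 1].
Definition pZp : set Q := [set p%:R * x | x in Zp].

Definition first_a x : int := padic_val x.

Definition first_b x : nat :=
  xget 0%N [set b | (0 < b < p)%N /\ pZp (p%:R ^ first_a x / x - b%:R)].

Definition schneider x : Q :=
  if x == 0 then 0 else p%:R ^ first_a x / x - (first_b x)%:R.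

Lemma first_bP x : x != 0 ->
  (0 < first_b x < p)%N /\ pZp (p%:R ^ first_a x / x - (first_b x)%:R).
Proof.
move=> x0; rewrite /first_b; set B := [set b | _].
suff exB : exists b, B b by exact: (xgetPex 0%N exB).
have [k [u [uU xE]]] := padic_decompQ x0.
have wU : u^-1 \is a GRing.unit by rewrite unitrV.
exists (u^-1 1%N); split.
  rewrite lt0n -padic_unitE wU -[X in (_ < X)%N]expn1 -residue_mod.
  by rewrite ltn_pmod// expn1 prime_gt0.
have -> : p%:R ^ first_a x / x = of_padic_int R u^-1.
  have pk0 : p%:R ^ first_a x != 0 :> Q.
    exact: expfz_neq0 (padic_p_neq0 _ _).
  have := xE; rewrite -{1}(padic_valE R k uU) -xE -/(first_a x) => xE'.
  have -> : of_padic_int R u^-1 = (of_padic_int R u)^-1 by exact: rmorphV.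
  by rewrite {2}xE' invfM mulVKf.
have w1 : (u^-1 - (u^-1 1%N)%:R) 1%N = 0%N.
  exact: residue_subn.
have [y [yE _]] := padic_divX w1.
rewrite -(rmorph_nat (@of_padic_int R p p_pr)) -rmorphB yE.
rewrite rmorphM rmorphXn rmorph_nat.
by exists (of_padic_int R y) => //; exact: padic_norm_int.
Qed.

Lemma schneider_pZp x : pZp (schneider x).
Proof.
rewrite /schneider; case: eqVneq => [_|/first_bP[]//].
by exists 0; rewrite ?mulr0// /Zp /= padic_norm0.
Qed.

(* Meaningful only for n > 0 and iter n.-1 schneider x != 0. *)
Definition digit_a (n : nat) x : int := first_a (iter n.-1 schneider x).

(* If some iterate of x vanishes, the expansion of x is finite and the series
   runs over the finitely many digits of x. *)
Definition digit_series x (s : R) : \bar R :=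
  (\sum_(1 <= n <oo | iter n.-1 schneider x != 0%R)
    (((digit_a n x)%:~R `^ (- s))%:E))%E.

Definition conv_exponent x : \bar R :=
  ereal_inf [set s%:E | s in [set s | 0 <= s /\ (digit_series x s < +oo)%E]].

Definition exponent_set (alpha : \bar R) : set Q :=
  [set x | pZp x /\ conv_exponent x = alpha].

End SchneiderMap.

Arguments exponent_set {R p} p_pr alpha.

Section Hausdorff.
Variables (R : realType) (X : metricType R).
Implicit Types (E A : set X) (s delta : R).
Local Open Scope ereal_scope.

Definition diam A : \bar R :=
  ereal_sup [set (mdist z.1 z.2)%:E | z in A `*` A].

(* The empty set contributes 0 even for s = 0, so finite covers are included. *)
Definition diam_pow s A : \bar R :=
  if pselect (A = set0) then 0 else poweR (diam A) s.

Definition hausdorff_premeasure s delta E : \bar R :=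
  ereal_inf [set \sum_(0 <= i <oo) diam_pow s (U i) | U in
    [set U : (set X)^nat | E `<=` \bigcup_i U i /\
                           forall i, diam (U i) <= delta%:E]].

Definition hausdorff_measure s E : \bar R :=
  ereal_sup [set hausdorff_premeasure s delta E | delta in
    [set delta | (0 < delta)%R]].

Definition hausdorff_dim E : \bar R :=
  ereal_inf [set s%:E | s in
    [set s | (0 <= s)%R /\ hausdorff_measure s E = 0]].

End Hausdorff.

(* Main.v *)
Require Import Defs.
From HB Require Import structures.
From mathcomp Require Import all_boot all_order all_algebra.
From mathcomp Require Import all_classical all_reals all_analysis.
From mathcomp Require Import ring lra.

(* If tau(x) is finite then, for every M, the digits of x are eventually at
   least M or the expansion stops. On the digit cylinder (a, b) the map T_p
   expands distances by exactly p^a, so the set D of points all of whose digits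
   are at least M is covered by {0} and by the images of D under inverse branches
   of ratio p^(-a), a >= M. Hence h(D) <= theta h(D) for the s-dimensional
   premeasure h, with theta < 1 when M is large, and h(D) = 0 since h is finite
   on p Z_p. Pulling back along the branches, {tau < oo} is null for every
   s > 0, which settles the finite exponents. The same self-similarity argument
   for p Z_p, a union of p copies of itself of ratio 1/p, gives
   H^s(p Z_p) = 0 for s > 1. Conversely H^1(p Z_p) > 0: reversing base p digits
   maps [0, 1[ into p Z_p with a Lipschitz inverse. Since {tau < oo} is H^1-null,
   H^1(T(oo)) > 0. *)

Set Implicit Arguments.
Unset Strict Implicit.
Unset Printing Implicit Defensive.

Import Order.TTheory GRing.Theory Num.Theory.

Local Open Scope classical_set_scope.
Local Open Scope ring_scope.

(** * Real powers, geometric series and tails of convergent series *)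

Lemma powR_exprn (R : realType) (a s : R) n : 0 <= a ->
  (a ^+ n) `^ s = (a `^ s) ^+ n.
Proof.
by move=> a0; rewrite -(powR_mulrn n a0) powRAC powR_mulrn// powR_ge0.
Qed.

Lemma geometric_eseries_le (R : realType) (C q : R) : 0 <= C -> 0 <= q < 1 ->
  (\sum_(0 <= k <oo) (C * q ^+ k)%:E <= (C / (1 - q))%:E)%E.
Proof.
move=> C0 /andP[q0 q1]; apply: lime_le.
  by apply: is_cvg_nneseries => n _ _; rewrite lee_fin mulr_ge0// exprn_ge0.
apply: nearW => n; rewrite sumEFin lee_fin.
have := @geometric_seriesE R C q; rewrite lt_eqF// => /(_ isT)/(congr1 (@^~ n)).
rewrite /series/= => ->.
by rewrite ler_pM2r ?invr_gt0 ?subr_gt0// ler_piMr// gerBl exprn_ge0.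
Qed.

Lemma powR_lt1 (R : realType) (a s : R) : 0 <= a < 1 -> 0 < s -> a `^ s < 1.
Proof.
move=> /andP[a0 a1] s0; have := @gt0_ltr_powR R s s0 a 1.
by rewrite !nnegrE a0 ler01 powR1; exact.
Qed.

Lemma exprn_lt (R : realType) (q e : R) : 0 <= q < 1 -> 0 < e ->
  exists n, q ^+ n < e.
Proof.
move=> /andP[q0 q1] e0; have /cvgrPdist_lt/(_ _ e0) : q ^+ n @[n --> \oo] --> 0.
  by apply: cvg_expr; rewrite ger0_norm.
move=> [N _ /(_ N (leqnn N))] /=; rewrite sub0r normrN ger0_norm ?exprn_ge0//.
by exists N.
Qed.

(** The tails of a convergent series tend to 0, and a tail of nonnegative terms dominates its first
    term. *)
Lemma nneseries_lty_small (R : realType) (u : nat -> \bar R) (P : pred nat)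
    (m : nat) (c : R) : (forall n, P n -> 0 <= u n)%E -> 0 < c ->
  (\sum_(m <= n <oo | P n) u n < +oo)%E ->
  exists N, forall n, (N <= n)%N -> P n -> (u n < c%:E)%E.
Proof.
move=> u0 c0; rewrite eseries_cond => fin_u.
have {}u0 n : P n && (m <= n)%N -> (0 <= u n)%E by move=> /andP[/u0].
have := nneseries_tail_cvg fin_u u0.
have c0' : (0 < c%:E)%E by rewrite lte_fin.
move=> /(_ [set y | (y < c%:E)%E] (lt_nbhsl c0')) [N _ tailN].
exists (maxn m N) => n; rewrite geq_max => /andP[mn Nn] Pn.
apply: le_lt_trans (tailN n Nn).
apply: le_trans (nneseries_lim_ge n.+1 _) => [|k _ /u0//].
by rewrite big_ltn_cond// Pn mn big_geq// adde0.
Qed.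

(** * Hausdorff premeasures *)

Section DiscreteSemiring.
Variables (T : choiceType) (x0 : T).

(** An alias of [T] that carries the semiring of all subsets. It depends on [x0] so that any chosen
    point can serve as its base point. *)
Definition discrete_space of T : Type := T.
Local Notation D := (discrete_space x0).

HB.instance Definition _ := Choice.on D.
HB.instance Definition _ := isPointed.Build D x0.

Let discrete0 : [set: set D] set0. Proof. by []. Qed.
Let discreteI : setI_closed [set: set D]. Proof. by []. Qed.
Let discreteD : semi_setD_closed [set: set D].
Proof. exact: setD_semi_setD_closed. Qed.

HB.instance Definition _ := @isSemiRingOfSets.Build default_measure_display D
  [set: set D] discrete0 discreteI discreteD.

End DiscreteSemiring.

Section HausdorffOuterMeasure.
Context {R : realType} {X : metricType R}.
Implicit Types (A B E : set X) (s delta : R).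
Local Open Scope ereal_scope.

(** Being the supremum of no distances, this meets every bound on diameters, so empty sets can pad a
    cover. *)
Lemma diam0 : diam (set0 : set X) = -oo.
Proof. by rewrite /diam set0X image_set0 ereal_sup0. Qed.

Lemma diam_le A (d : \bar R) :
  (forall x y, A x -> A y -> (mdist x y)%:E <= d) -> diam A <= d.
Proof.
by move=> Ad; apply: ge_ereal_sup => _ [[x y] [/= Ax Ay] <-]; exact: Ad.
Qed.

Lemma le_diam A x y : A x -> A y -> (mdist x y)%:E <= diam A.
Proof. by move=> Ax Ay; apply: ereal_sup_ubound; exists (x, y). Qed.

Lemma diam_ge0 A : A !=set0 -> 0 <= diam A.
Proof. by case=> x Ax; have := le_diam Ax Ax; rewrite mdistxx. Qed.

Lemma diam_pow_set0 s : diam_pow s (set0 : set X) = 0.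
Proof. by rewrite /diam_pow; case: pselect. Qed.

Lemma diam_powE s A : A !=set0 -> diam_pow s A = diam A `^ s.
Proof. by rewrite /diam_pow; case: pselect => // A0 /set0P/eqP. Qed.

Lemma diam_pow_ge0 s A : 0 <= diam_pow s A.
Proof. by rewrite /diam_pow; case: pselect => // ?; exact: poweR_ge0. Qed.

Lemma hausdorff_premeasure_le s delta E (U : (set X)^nat) :
  E `<=` \bigcup_i U i -> (forall i, diam (U i) <= delta%:E) ->
  hausdorff_premeasure s delta E <= \sum_(0 <= i <oo) diam_pow s (U i).
Proof. by move=> EU dU; apply: ereal_inf_lbound; exists U. Qed.

Lemma hausdorff_premeasure_ge0 s delta E : 0 <= hausdorff_premeasure s delta E.
Proof.
apply: le_ereal_inf_tmp => _ [U _ <-].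
by apply: nneseries_ge0 => n _ _; exact: diam_pow_ge0.
Qed.

Lemma le_hausdorff_premeasure s delta :
  {homo @hausdorff_premeasure R X s delta : A B / (A `<=` B)%classic >-> A <= B}.
Proof.
move=> A B AB; apply/ereal_inf_le_tmp => _ [U [BU dU] <-].
by exists U => //; split=> //; exact: subset_trans AB BU.
Qed.

Lemma hausdorff_premeasure_anti s delta delta' E : (delta <= delta')%R ->
  hausdorff_premeasure s delta' E <= hausdorff_premeasure s delta E.
Proof.
move=> dd; apply/ereal_inf_le_tmp => _ [U [EU dU] <-].
by exists U => //; split=> // i; rewrite (le_trans (dU i)).
Qed.

Lemma hausdorff_premeasure0 s delta :
  hausdorff_premeasure s delta (set0 : set X) = 0.
Proof.
apply/eqP; rewrite eq_le hausdorff_premeasure_ge0 andbT.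
rewrite (@le_trans _ _ (\sum_(0 <= i <oo) diam_pow s (set0 : set X)))//.
  by apply: hausdorff_premeasure_le => // i; rewrite diam0 leNye.
by rewrite eseries0// => *; exact: diam_pow_set0.
Qed.

Let gauge s delta A : \bar R :=
  if diam A <= delta%:E then diam_pow s A else +oo.

Let gauge0 s delta : gauge s delta set0 = 0.
Proof. by rewrite /gauge diam0 leNye diam_pow_set0. Qed.

Let gauge_ge0 s delta A : 0 <= gauge s delta A.
Proof. by rewrite /gauge; case: ifP => // _; exact: diam_pow_ge0. Qed.

(* With the gauge taken infinite on large sets, the premeasure is the outer
   measure that the library builds from covers, on the semiring of all sets. *)
Let hausdorff_premeasureE (x0 : X) s delta :
  @hausdorff_premeasure R X s delta =
  @mu_ext _ (discrete_space x0) R (gauge s delta).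
Proof.
apply/funext => E; apply/eqP; rewrite eq_le; apply/andP; split; last first.
  apply/ereal_inf_le_tmp => _ [U [EU dU] <-]; exists U; first by split.
  by apply: eq_eseriesr => i _; rewrite /gauge dU.
apply: le_ereal_inf_tmp => _ [U [_ EU] <-].
have [dU|] := pselect (forall i, diam (U i : set X) <= delta%:E).
  rewrite (eq_eseriesr (g := fun i => diam_pow s (U i : set X))).
    exact: hausdorff_premeasure_le.
  by move=> i _; rewrite /gauge dU.
(* A single set that is too large makes the whole sum of gauges infinite. *)
move=> /existsNP[i /negP dUi]; rewrite (eseries_pinfty (k := i)) ?leey//.
  by move=> n _; rewrite gt_eqF// (lt_le_trans _ (gauge_ge0 _ _ _)).
by rewrite /gauge (negbTE dUi).
Qed.

Lemma hausdorff_premeasure_sigma_subadditive s delta :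
  sigma_subadditive (@hausdorff_premeasure R X s delta).
Proof.
(* A point of the union serves as base point of [discrete_space]; an empty union has premeasure
   0. *)
move=> F; have [[x _]|F0] := pselect (\bigcup_n F n !=set0).
  rewrite (hausdorff_premeasureE x).
  by apply: mu_ext_sigma_subadditive => //; exact: gauge_ge0.
have -> : \bigcup_n F n = set0 by apply/eqP/negPn/negP => /set0P.
rewrite hausdorff_premeasure0.
by apply: nneseries_ge0 => n _ _; exact: hausdorff_premeasure_ge0.
Qed.

HB.instance Definition _ s delta := isOuterMeasure.Build R X
  (@hausdorff_premeasure R X s delta)
  (hausdorff_premeasure0 s delta) (hausdorff_premeasure_ge0 s delta)
  (@le_hausdorff_premeasure s delta)
  (@hausdorff_premeasure_sigma_subadditive s delta).

Lemma hausdorff_premeasure_set1 s delta (x : X) : (0 < s)%R ->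
  (0 <= delta)%R -> hausdorff_premeasure s delta [set x] = 0.
Proof.
move=> s0 d0; apply/eqP; rewrite eq_le hausdorff_premeasure_ge0 andbT.
have dx : diam [set x] = 0.
  apply/eqP; rewrite eq_le diam_ge0; last by exists x.
  by rewrite andbT; apply: diam_le => _ _ -> ->; rewrite mdistxx.
apply: (le_trans (hausdorff_premeasure_le s (U := fun=> [set x]) _ _)).
- by move=> y ->; exists 0%N.
- by move=> i; rewrite dx lee_fin.
rewrite eseries0// => n _ _; rewrite diam_powE ?dx ?poweR0r ?gt_eqF//.
by exists x.
Qed.

(** A supremum of nonnegative values vanishes exactly when all of them do. Nullity can thus be
    proved at one fixed scale at a time. *)
Lemma hausdorff_measure0P s E : hausdorff_measure s E = 0 <->
  forall delta, (0 < delta)%R -> hausdorff_premeasure s delta E = 0.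
Proof.
split=> [E0 delta d0|E0].
  apply/eqP; rewrite eq_le hausdorff_premeasure_ge0 andbT -E0.
  by apply: ereal_sup_ubound; exists delta.
rewrite /hausdorff_measure (_ : [set _ | _ in _] = [set 0]) ?ereal_sup1//.
apply/seteqP; split=> [_ [delta /= d0 <-]|_ ->]; first exact: E0.
by exists 1%R => //=; exact: E0.
Qed.

Lemma le_hausdorff_measure0 s A B : A `<=` B ->
  hausdorff_measure s B = 0 -> hausdorff_measure s A = 0.
Proof.
move=> AB /hausdorff_measure0P B0; apply/hausdorff_measure0P => delta d0.
by apply/eqP; rewrite eq_le hausdorff_premeasure_ge0 andbT -(B0 _ d0)
  le_hausdorff_premeasure.
Qed.

Lemma hausdorff_measure0_bigcup s (F : (set X)^nat) :
  (forall n, hausdorff_measure s (F n) = 0) ->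
  hausdorff_measure s (\bigcup_n F n) = 0.
Proof.
move=> F0; apply/hausdorff_measure0P => delta d0.
apply/eqP; rewrite eq_le hausdorff_premeasure_ge0 andbT.
apply: (le_trans (outer_measure_sigma_subadditive _ _)).
by rewrite eseries0// => n _ _ /=; have /hausdorff_measure0P := F0 n; apply.
Qed.

Lemma hausdorff_dim_ge0 E : 0 <= hausdorff_dim E.
Proof. by apply: le_ereal_inf_tmp => _ [s [s0 _] <-]; rewrite lee_fin. Qed.

Lemma hausdorff_dim_le (d : R) E : (0 <= d)%R ->
  (forall s, (d < s)%R -> hausdorff_measure s E = 0) -> hausdorff_dim E <= d%:E.
Proof.
move=> d0 E0; apply/lee_addgt0Pr => e e0; apply: ereal_inf_lbound.
exists (d + e)%R => //; split; first by rewrite addr_ge0// ltW.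
by apply: E0; rewrite ltrDl.
Qed.

(* For diameters at most 1 the s-th power decreases with s. *)
Lemma hausdorff_measure1_eq0 s E : (0 <= s <= 1)%R ->
  hausdorff_measure s E = 0 -> hausdorff_measure 1 E = 0.
Proof.
move=> /andP[s0 s1] /hausdorff_measure0P E0; apply/hausdorff_measure0P => delta d0.
have m0 : (0 < Num.min delta 1)%R by rewrite lt_min d0 ltr01.
apply/eqP; rewrite eq_le hausdorff_premeasure_ge0 andbT -(E0 _ m0).
apply: le_ereal_inf_tmp => _ [U [EU dU] <-].
apply: (le_trans (hausdorff_premeasure_le 1 EU _)) => [i|].
  by rewrite (le_trans (dU i))// lee_fin ge_min lexx.
apply: lee_nneseries => [i _ _|i _]; first exact: diam_pow_ge0.
have [->|/set0P U0] := eqVneq (U i) set0; first by rewrite !diam_pow_set0.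
have dU0 := diam_ge0 U0; rewrite !diam_powE// poweRe1//.
have : diam (U i) <= 1 by rewrite (le_trans (dU i))// lee_fin ge_min lexx orbT.
move: dU0; case: (diam (U i)) => // r; rewrite !lee_fin => r0 r1.
have [->|rN0] := eqVneq r 0%R; first exact: powR_ge0.
by rewrite ger1_powR// r1 lt_neqAle eq_sym rN0 r0.
Qed.

End HausdorffOuterMeasure.

(** * Lipschitz images and countable systems of contractions *)

Section HausdorffLipschitz.
Context {R : realType} {X Y : metricType R}.
Local Open Scope ereal_scope.

(** Each set of a cover is replaced by the image of its trace on [E], where the Lipschitz bound
    holds; this multiplies diameters by at most [c]. *)
Lemma hausdorff_premeasure_lipschitz (f : X -> Y) (E : set X) (c s delta : R) :
  (0 < c)%R -> (0 <= s)%R ->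
  (forall x y, E x -> E y -> (mdist (f x) (f y) <= c * mdist x y)%R) ->
  hausdorff_premeasure s (c * delta) (f @` E) <=
  (c `^ s)%:E * hausdorff_premeasure s delta E.
Proof.
move=> c0 s0 fE; rewrite -ereal_inf_pZl ?powR_gt0//.
apply: le_ereal_inf_tmp => _ [_ [U [EU dU] <-] <-].
have dfU i : diam (f @` (U i `&` E)) <= c%:E * diam (U i).
  apply: diam_le => _ _ [x [Ux Ex] <-] [y [Uy Ey] <-].
  apply: (@le_trans _ _ (c%:E * (mdist x y)%:E)).
    by rewrite -EFinM lee_fin; exact: fE.
  by rewrite lee_pmul2l// le_diam.
apply: (le_trans (hausdorff_premeasure_le s (U := fun i => f @` (U i `&` E)) _ _)).
- by move=> _ [x Ex <-]; have [i _ Ux] := EU x Ex; exists i => //; exists x.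
- by move=> i; rewrite (le_trans (dfU i))// EFinM lee_pmul2l.
rewrite -nneseriesZl; last by move=> *; exact: diam_pow_ge0.
apply: lee_nneseries => [i _ _|i _]; first exact: diam_pow_ge0.
have [->|/set0P fUE] := eqVneq (f @` (U i `&` E)) set0.
  by rewrite diam_pow_set0 mule_ge0 ?diam_pow_ge0// lee_fin powR_ge0.
have U0 : U i !=set0 by case: fUE => _ [x [Ux _] _]; exists x.
rewrite !diam_powE// -poweR_EFin -poweRM ?diam_ge0 ?lee_fin ?(ltW c0)//.
have cU0 : 0 <= c%:E * diam (U i) by rewrite mule_ge0 ?diam_ge0// lee_fin ltW.
by apply: (gt0_ler_poweR s0); rewrite ?in_itv/= ?leey ?andbT ?diam_ge0.
Qed.

End HausdorffLipschitz.

Section IteratedFunctionSystem.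
Context {R : realType} {X : metricType R}.
Implicit Types (A E Z : set X) (s delta : R).
Local Open Scope ereal_scope.

Lemma hausdorff_premeasure_le_diam s delta E : diam E <= delta%:E ->
  hausdorff_premeasure s delta E <= diam_pow s E.
Proof.
move=> Ed; pose U n := if n is 0%N then E else set0.
apply: (le_trans (hausdorff_premeasure_le s (U := U) _ _)).
- by move=> x Ex; exists 0%N.
- by case=> //= _; rewrite diam0 leNye.
rewrite nneseries_recl//=; last by move=> *; exact: diam_pow_ge0.
rewrite eseries_cond eseries0 ?adde0// => -[//|n] _ _ /=.
exact: diam_pow_set0.
Qed.

(** For c <= 1 the scale can be kept: c delta <= delta, and a larger scale gives a smaller
    premeasure. *)
Lemma hausdorff_premeasure_contraction (f : X -> X) A (c s delta : R) :
  (0 < c <= 1)%R -> (0 <= s)%R -> (0 <= delta)%R ->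
  (forall x y, A x -> A y -> (mdist (f x) (f y) <= c * mdist x y)%R) ->
  hausdorff_premeasure s delta (f @` A) <=
  (c `^ s)%:E * hausdorff_premeasure s delta A.
Proof.
move=> /andP[c0 c1] s0 d0 fA; apply: le_trans (hausdorff_premeasure_lipschitz _ c0 s0 fA).
by apply: hausdorff_premeasure_anti; rewrite ler_piMl.
Qed.

(** There are [m] branches of ratio [c k] for each [k], and [Z] absorbs the points on no branch.
    With E = A and theta < 1 the bound forces premeasure 0; with E different from A it pulls nullity
    back from [A] to [E]. *)
Lemma hausdorff_premeasure_ifs s delta (m : nat) (c : nat -> R)
    (f : nat -> nat -> X -> X) A E Z (theta : R) :
  (0 <= s)%R -> (0 <= delta)%R -> (forall k, 0 < c k <= 1)%R ->
  (forall k b x y, (b < m)%N -> A x -> A y ->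
    (mdist (f k b x) (f k b y) <= c k * mdist x y)%R) ->
  E `<=` Z `|` \bigcup_k \bigcup_(b in `I_m) (f k b @` A) ->
  hausdorff_premeasure s delta Z = 0 ->
  \sum_(0 <= k <oo) (m%:R * c k `^ s)%:E <= theta%:E ->
  hausdorff_premeasure s delta A \is a fin_num ->
  hausdorff_premeasure s delta E <= theta%:E * hausdorff_premeasure s delta A.
Proof.
move=> s0 d0 c01 fA EZ Z0 ctheta Afin.
apply: (le_trans (le_outer_measure _ _ _ EZ)).
apply: (le_trans (outer_measureU2 _ _ _)) => /=; rewrite Z0 add0e.
apply: (le_trans (outer_measure_sigma_subadditive _ _)) => /=.
have hA0 := hausdorff_premeasure_ge0 s delta A.
apply: (@le_trans _ _ (\sum_(0 <= k <oo)
    (hausdorff_premeasure s delta A * (m%:R * c k `^ s)%:E))).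
  apply: lee_nneseries => [k _ _|k _]; first exact: hausdorff_premeasure_ge0.
  rewrite bigcup_mkord.
  apply: (le_trans (outer_measure_subadditive _ (fun b => f k b @` A) _)) => /=.
  rewrite (@le_trans _ _ (\sum_(i < m)
      (c k `^ s)%:E * hausdorff_premeasure s delta A))//.
    apply: lee_sum => i _; apply: hausdorff_premeasure_contraction => //.
    by move=> x y; exact: fA.
  rewrite -(fineK Afin) -!EFinM sumEFin lee_fin sumr_const card_ord.
  by rewrite -[leLHS]mulr_natl mulrA mulrC.
rewrite -(fineK Afin) nneseriesZl; last first.
  by move=> k _; rewrite lee_fin mulr_ge0// powR_ge0.
by rewrite muleC lee_wpmul2r// lee_fin fine_ge0.
Qed.

End IteratedFunctionSystem.

(** * Positivity of H^1 by comparison with Lebesgue measure *)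

Section LipschitzParametrization.
Context {R : realType} {X : metricType R}.
Local Open Scope ereal_scope.

(* The inverse of f turns a cover of E into a cover of the unit interval by
   intervals of comparable length. *)
Lemma hausdorff_measure1_neq0 (f : R -> X) (L : R) (E : set X) : (0 < L)%R ->
  f @` `[0%R, 1%R[ `<=` E ->
  (forall x y, `[0%R, 1%R[%classic x -> `[0%R, 1%R[%classic y ->
    (`|x - y| <= L * mdist (f x) (f y))%R) ->
  hausdorff_measure 1 E != 0.
Proof.
move=> L0 fE fL; apply/eqP => /hausdorff_measure0P /(_ 1%R ltr01) E0.
(* Each set of the cover will give an interval of length at most 2L times its diameter, so a sum
   below 1/(2L) leaves total length below 1. *)
have : hausdorff_premeasure 1 1 E < ((2 * L)^-1)%:E.
  by rewrite E0 lte_fin invr_gt0 mulr_gt0.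
move=> /ereal_inf_lt[_ [U [EU dU] <-] sumU].
pose cover i (I : set R) := [/\ measurable I,
  `[0%R, 1%R[ `&` f @^-1` U i `<=` I &
  lebesgue_measure I <= (2 * L)%:E * diam_pow 1 (U i)].
have /choice[I coverI] i : exists I, cover i I.
  have [[a [a01 Ua]]|nU] := pselect ((`[0%R, 1%R[ `&` f @^-1` U i) !=set0); last first.
    exists set0; split => //; first by move=> x Ux; apply: nU; exists x.
    by rewrite measure0 mule_ge0 ?diam_pow_ge0// lee_fin mulr_ge0// ltW.
  have U0 : U i !=set0 by exists (f a).
  have dfin : diam (U i) \is a fin_num.
    by rewrite ge0_fin_numE ?diam_ge0// (le_lt_trans (dU i))// ltry.
  have d0 : (0 <= L * fine (diam (U i)))%R by rewrite mulr_ge0 ?fine_ge0 ?diam_ge0// ltW.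
  set r := (L * fine (diam (U i)))%R in d0 *.
  (* Any point [a] of the preimage can be the centre: the others lie within L times the diameter. *)
  exists (`[(a - r)%R, (a + r)%R]%classic); split.
  - exact: measurable_itv.
  - move=> x [x01 Ux]; rewrite /= in_itv/= -ler_distlC.
    apply: (le_trans (fL _ _ a01 x01)); rewrite /r ler_pM2l//.
    by rewrite -lee_fin fineK// le_diam.
  - rewrite diam_powE// poweRe1 ?diam_ge0//.
    rewrite -[in leRHS](fineK dfin) -EFinM lebesgue_measure_itv/= lte_fin.
    have -> : (2 * L * fine (diam (U i)) = 2 * r)%R by rewrite /r mulrA.
    by case: ifP => _; rewrite -?EFinB lee_fin; lra.
have : lebesgue_measure (`[0%R, 1%R[%classic : set R) <= \sum_(0 <= i <oo) lebesgue_measure (I i).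
  apply: measure_sigma_subadditive => //.
  - by move=> i; have [] := coverI i.
  - move=> x x01; have [i _ Ui] := EU _ (fE _ (imageP f x01)).
    by exists i => //; have [_ + _] := coverI i; apply.
rewrite lebesgue_measure_itv/= lte_fin ltr01 oppr0 adde0; apply/negP; rewrite -ltNge.
apply: (@le_lt_trans _ _ (\sum_(0 <= i <oo) (2 * L)%:E * diam_pow 1 (U i))).
  by apply: lee_nneseries => [i _ _|i _]; [exact: measure_ge0|have [] := coverI i].
rewrite nneseriesZl; last by move=> i _; exact: diam_pow_ge0.
by rewrite -lte_pdivlMl ?mulr_gt0// mule1.
Qed.

End LipschitzParametrization.

(** * Inverse branches of the Schneider map *)

Lemma subr_div_div (F : fieldType) (a u v : F) : u != 0 -> v != 0 ->
  a / u - a / v = a * (v - u) * (u * v)^-1.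
Proof. by move=> u0 v0; field; rewrite u0 v0. Qed.

Lemma div_divK (F : fieldType) (c x : F) : c != 0 -> c / (c / x) = x.
Proof. by move=> c0; rewrite invfM invrK mulVKf. Qed.

Section PadicBalls.
Variables (R : realType) (p : nat) (p_pr : prime p).
Local Notation Z := (padic_int p_pr).
Local Notation Q := (padic R p_pr).
Implicit Types (x y : Q) (u : Z) (a b j k M N : nat).

Let p_gt0 : 0 < p%:R :> R. Proof. by rewrite ltr0n prime_gt0. Qed.
Let p_gt1 : 1 < p%:R :> R. Proof. by rewrite ltr1n prime_gt1. Qed.
Let pQ_neq0 : p%:R != 0 :> Q. Proof. exact: padic_p_neq0. Qed.

Lemma padic_norm_pX k : padic_norm (p%:R ^+ k : Q) = p%:R ^- k.
Proof.
have := @padic_normE R p p_pr k%:Z 1 (unitr1 _).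
by rewrite rmorph1 mulr1 -exprnP -exprnN.
Qed.

Lemma padic_norm_nat b : (0 < b < p)%N -> padic_norm (b%:R : Q) = 1.
Proof.
move=> /andP[b0 bp]; have bU : (b%:R : Z) \is a GRing.unit.
  by rewrite padic_unitE residue_nat expn1 modn_small// -lt0n.
have := @padic_normE R p p_pr 0 _ bU.
by rewrite rmorph_nat expr0z mul1r oppr0 expr0z.
Qed.

(** A negative valuation would make the norm exceed 1, so the unit ball consists of p-adic
    integers. *)
Lemma Zp_of_padic_int x : Defs.Zp x -> exists u, x = of_padic_int R u.
Proof.
have [->|/padic_decompQ[k [u [uU ->]]]] := eqVneq x 0.
  by exists 0; rewrite rmorph0.
rewrite /Defs.Zp /= padic_normE//; case: k => [n _|n].
  by exists (p%:R ^+ n * u); rewrite rmorphM rmorphXn rmorph_nat.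
by rewrite NegzE opprK -exprnP leNgt exprn_egt1.
Qed.

Lemma pZpE x : pZp x <-> padic_norm x <= p%:R^-1.
Proof.
have np : padic_norm (p%:R : Q) = p%:R^-1 by have := padic_norm_pX 1.
split=> [[z zZ <-]|xp].
  by rewrite padic_normM np ger_pMr ?invr_gt0.
exists (p%:R^-1 * x); last by rewrite mulVKf.
rewrite /Defs.Zp /= -(ler_pM2l (x := p%:R^-1)) ?invr_gt0// mulr1.
by rewrite -np -padic_normM mulVKf// np.
Qed.

(** Write x = p u and split off the residue of u modulo p, as u = j + p v. This exhibits p Z_p as a
    union of p copies of itself of ratio 1/p. *)
Lemma pZp_digit x : pZp x ->
  exists j y, [/\ (j < p)%N, pZp y & x = p%:R * j%:R + p%:R * y].
Proof.
move=> [_ /Zp_of_padic_int[u ->] <-].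
have [v [vE _]] := padic_divX (@residue_subn p p_pr u 1).
exists (u 1%N), (p%:R * of_padic_int R v); split.
- by rewrite -[X in (_ < X)%N]expn1 -residue_mod ltn_pmod// expn1 prime_gt0.
- by exists (of_padic_int R v) => //; exact: padic_norm_int.
- rewrite -mulrDr; congr (_ * _).
  rewrite -{1}[u](subrK (u 1%N)%:R) vE expr1 rmorphD rmorphM.
  by rewrite !rmorph_nat addrC.
Qed.

(** The solution x of p^a / x - b = y, which inverts [schneider] on the points with first digits a
    and b. *)
Definition inverse_branch (a b : nat) (y : Q) : Q := p%:R ^+ a / (b%:R + y).

Lemma padic_norm_natD b y : (0 < b < p)%N -> pZp y ->
  padic_norm (b%:R + y) = 1.
Proof.
move=> bp /pZpE yp; have y1 : padic_norm y < 1.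
  by rewrite (le_lt_trans yp)// invf_lt1.
apply/eqP; rewrite eq_le; apply/andP; split.
  by rewrite (le_trans (padic_normD _ _))// ge_max padic_norm_nat// lexx ltW.
(* Since b = (b + y) - y has norm 1 and |y| < 1, the ultrametric inequality gives |b + y| >= 1. *)
have := padic_normD (b%:R + y) (- y); rewrite addrK padic_norm_nat// padic_normN.
by rewrite le_max => /orP[//|]; rewrite leNgt y1.
Qed.

Lemma padic_norm_unitV x : padic_norm x = 1 -> padic_norm x^-1 = 1.
Proof.
move=> x1; have [x0|x0] := eqVneq x 0; first by rewrite x0 invr0 -x0.
have := padic_normM x x^-1; rewrite (divff x0) x1 mul1r => <-.
by have := padic_norm_pX 0; rewrite !expr0 invr1.
Qed.

(** The two values differ by p^a (y - x) / ((b + x)(b + y)), and both factors of the denominator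
    have norm 1. *)
Lemma inverse_branch_dist a b x y : (0 < b < p)%N -> pZp x -> pZp y ->
  mdist (inverse_branch a b x) (inverse_branch a b y) = p%:R ^- a * mdist x y.
Proof.
move=> bp xp yp; rewrite /mdist/= /padic_dist.
have n0 (z : Q) : pZp z -> b%:R + z != 0.
  move=> zp; apply/eqP => bz; have := padic_norm_natD bp zp.
  by rewrite bz padic_norm0 => /esym/eqP; rewrite oner_eq0.
have -> : inverse_branch a b x - inverse_branch a b y =
    p%:R ^+ a * (y - x) * ((b%:R + x) * (b%:R + y))^-1.
  rewrite /inverse_branch; move: (n0 x xp) (n0 y yp).
  set u := b%:R + x; set v := b%:R + y => u0 v0.
  have -> : y - x = v - u by rewrite opprD addrACA subrr add0r.
  exact (subr_div_div (p%:R ^+ a : Q) u0 v0).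
have nu1 : padic_norm ((b%:R + x) * (b%:R + y))^-1 = 1.
  apply: padic_norm_unitV.
  by rewrite padic_normM (padic_norm_natD bp xp) (padic_norm_natD bp yp) mulr1.
by rewrite !padic_normM padic_norm_pX nu1 mulr1 -padic_normN opprB.
Qed.

Lemma first_branch x : pZp x -> x != 0 ->
  exists a b, [/\ first_a x = a%:Z, (0 < a)%N, (0 < b < p)%N &
                  x = inverse_branch a b (schneider x)].
Proof.
move=> xp x0; have [bp _] := first_bP x0.
have [k [u [uU xE]]] := padic_decompQ x0.
have ka : first_a x = k by rewrite /first_a xE padic_valE.
(* The norm of x is below 1, which excludes valuations k <= 0. *)
have : (p%:R : R) ^ (- k) < 1.
  move: xp => /pZpE; rewrite xE padic_normE// => /le_lt_trans; apply.
  by rewrite invf_lt1.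
case: k xE ka => [[|a] _ ka|n _ _]; last 1 first.
- by rewrite NegzE opprK -exprnP ltNge exprn_ege1// ltW.
- by rewrite oppr0 expr0z ltxx.
move=> _.
exists a.+1, (first_b x); split=> //.
rewrite /inverse_branch /schneider (negbTE x0) subrKC ka -exprnP.
exact (esym (div_divK x (expf_neq0 a.+1 pQ_neq0))).
Qed.

(** Iterate [n] carries the digit of index n + 1, so N = 0 constrains all digits. Allowing the value
    0 keeps finite expansions in the set. *)
Definition eventually_large_digits M N : set Q := [set x | pZp x /\
  forall n, (N <= n)%N -> iter n (@schneider R p p_pr) x = 0 \/
     M%:Z <= first_a (iter n (@schneider R p p_pr) x)].

Lemma eventually_large_digitsS M N x :
  eventually_large_digits M N.+1 x -> eventually_large_digits M N (schneider x).
Proof.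
move=> [_ xM]; split; first exact: schneider_pZp.
by move=> n Nn; rewrite -iterSr; exact: xM.
Qed.

Lemma eventually_large_digits0 M x :
  eventually_large_digits M 0 x -> eventually_large_digits M 0 (schneider x).
Proof.
move=> [_ xM]; split; first exact: schneider_pZp.
by move=> n Nn; rewrite -iterSr; exact: xM.
Qed.

End PadicBalls.

(** * Null sets in p Z_p: all of p Z_p for s > 1, large digits for s > 0 *)

Section PadicHausdorff.
Variables (R : realType) (p : nat) (p_pr : prime p).
Local Notation Q := (padic R p_pr).
Implicit Types (x y : Q) (s delta : R).
Local Open Scope ereal_scope.

Let p_gt0 : (0 < p%:R :> R)%R. Proof. by rewrite ltr0n prime_gt0. Qed.
Let p_gt1 : (1 < p%:R :> R)%R. Proof. by rewrite ltr1n prime_gt1. Qed.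
Let pV_ge0 : (0 <= p%:R^-1 :> R)%R. Proof. by rewrite invr_ge0 ltW. Qed.
Let pV_lt1 : (p%:R^-1 < 1 :> R)%R. Proof. by rewrite invf_lt1. Qed.

Lemma pZp_dist x y : pZp x -> pZp y -> (mdist x y <= p%:R^-1)%R.
Proof.
move=> /pZpE xp /pZpE yp; rewrite /mdist/= /padic_dist.
by rewrite (le_trans (padic_normD _ _))// padic_normN ge_max xp yp.
Qed.

(** At scale 1 the set covers itself. Splitting it into p copies of ratio 1/p refines the scale by
    1/p and costs a factor p p^(-s). *)
Lemma hausdorff_premeasure_pZp s k : (0 <= s)%R ->
  hausdorff_premeasure s (p%:R^-1 ^+ k) (@pZp R p p_pr) <=
  ((p%:R * p%:R^-1 `^ s) ^+ k)%:E.
Proof.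
move=> s0; elim: k => [|k IH].
  have pZp1 : diam (@pZp R p p_pr) <= 1.
    by apply: diam_le => x y xp yp; rewrite lee_fin (le_trans (pZp_dist xp yp))// ltW.
  have pZp0 : @pZp R p p_pr !=set0 by exists (schneider (0%R : Q)); exact: schneider_pZp.
  apply: (le_trans (hausdorff_premeasure_le_diam s pZp1)).
  rewrite expr0 diam_powE// -(poweR1r s); apply: (gt0_ler_poweR s0) => //.
  - by rewrite in_itv/= leey andbT diam_ge0.
  - by rewrite in_itv/= leey andbT lee_fin.
pose g (j : nat) (y : Q) : Q := (p%:R * j%:R + p%:R * y)%R.
have pZp_cover : @pZp R p p_pr `<=` \bigcup_(j in `I_p) (g j @` @pZp R p p_pr).
  move=> x /pZp_digit[j [y [jp yp ->]]].
  by exists j => //; exists y.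
apply: (le_trans (le_outer_measure _ _ _ pZp_cover)); rewrite bigcup_mkord.
apply: (le_trans (outer_measure_subadditive _ (fun j => g j @` @pZp R p p_pr) _)) => /=.
rewrite (@le_trans _ _ (\sum_(i < p) (p%:R^-1 `^ s *
    (p%:R * p%:R^-1 `^ s) ^+ k)%:E))//; last first.
  by rewrite sumEFin lee_fin sumr_const card_ord -[leLHS]mulr_natl mulrA exprS.
apply: lee_sum => i _; rewrite exprS EFinM.
apply: (le_trans (hausdorff_premeasure_lipschitz (c := p%:R^-1) (f := g i) _ _ s0 _)).
- by rewrite invr_gt0.
- move=> x y _ _; rewrite /mdist/= /padic_dist /g opprD addrACA subrr add0r.
  have := @padic_norm_pX R p p_pr 1; rewrite expr1 => np.
  by rewrite -mulrBr padic_normM np.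
- by rewrite lee_wpmul2l// lee_fin powR_ge0.
Qed.

Lemma hausdorff_premeasure_pZp_le s delta : (0 <= s)%R -> (0 < delta)%R ->
  exists N, forall k, (N <= k)%N -> hausdorff_premeasure s delta (@pZp R p p_pr) <=
  ((p%:R * p%:R^-1 `^ s) ^+ k)%:E.
Proof.
move=> s0 d0; have [|N pN] := @exprn_lt R p%:R^-1 delta _ d0.
  by rewrite pV_ge0 pV_lt1.
exists N => k Nk; apply: le_trans (hausdorff_premeasure_pZp k s0).
apply: hausdorff_premeasure_anti; rewrite (le_trans _ (ltW pN))//.
by apply: ler_wiXn2l => //; exact: ltW.
Qed.

Lemma hausdorff_premeasure_pZp_fin s delta : (0 <= s)%R -> (0 < delta)%R ->
  hausdorff_premeasure s delta (@pZp R p p_pr) < +oo.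
Proof.
move=> s0 /(hausdorff_premeasure_pZp_le s0)[N /(_ N (leqnn N))] h.
by rewrite (le_lt_trans h)// ltry.
Qed.

Lemma hausdorff_measure_pZp s : (1 < s)%R ->
  hausdorff_measure s (@pZp R p p_pr) = 0.
Proof.
move=> s1; have s0 : (0 <= s)%R by rewrite ltW// (lt_trans ltr01).
have theta01 : (0 <= (p%:R : R) * p%:R^-1 `^ s < 1)%R.
  (* Here p p^(-s) = (1/p)^(s - 1), which is below 1 because s > 1. *)
  rewrite -(mulr_powRB1 (x := p%:R^-1))//; last exact: lt_trans s1.
  by rewrite mulVKf ?gt_eqF// powR_ge0 powR_lt1 ?pV_ge0// subr_gt0.
apply/hausdorff_measure0P => delta d0.
apply/eqP; rewrite eq_le hausdorff_premeasure_ge0 andbT.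
apply/lee_addgt0Pr => e e0; rewrite add0e.
have [N hN] := hausdorff_premeasure_pZp_le s0 d0.
have [n ne] := exprn_lt theta01 e0.
apply: (le_trans (hN (maxn N n) (leq_maxl _ _))).
rewrite lee_fin (le_trans _ (ltW ne))//; case/andP: theta01 => t0 t1.
by rewrite ler_wiXn2l ?leq_maxr// ltW.
Qed.

(** With q = p^(-s), the factor bounds the sum over a >= M of (p - 1) q^a, coming from p - 1 inverse
    branches of ratio p^(-a) for each a. *)
Lemma hausdorff_premeasure_branches s delta (M : nat) (A E : set Q) :
  (0 < s)%R -> (0 < delta)%R -> A `<=` @pZp R p p_pr ->
  hausdorff_premeasure s delta A \is a fin_num ->
  (forall x, E x -> pZp x /\
    (x = 0%R \/ (M%:Z <= first_a x)%R /\ A (schneider x))) ->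
  hausdorff_premeasure s delta E <=
  (p.-1%:R * (p%:R^-1 `^ s) ^+ M / (1 - p%:R^-1 `^ s))%:E *
    hausdorff_premeasure s delta A.
Proof.
move=> s0 d0 Ap Afin EA.
have q1 : ((p%:R^-1 : R) `^ s < 1)%R by rewrite powR_lt1 ?pV_ge0.
(* The indices k, b stand for the digits M + k and b + 1. The point 0 is on no branch and is null as
   s > 0. *)
apply: (@hausdorff_premeasure_ifs _ _ s delta p.-1 (fun k => p%:R^-1 ^+ (M + k))%R
  (fun k b => inverse_branch (M + k) b.+1) A E [set 0%R]) => //.
- exact: ltW.
- exact: ltW.
- by move=> k; rewrite exprn_gt0 ?invr_gt0// exprn_ile1// ltW.
- move=> k b x y bp Ax Ay; rewrite inverse_branch_dist ?exprVn//; last 2 first.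
  + exact: Ap.
  + exact: Ap.
  by rewrite -ltn_predRL bp.
- move=> x /EA[xp [->|[Mx Ax]]]; first by left.
  have [->|x0] := eqVneq x 0%R; first by left.
  right; have [a [b [aE _ /andP[b0 bp] xE]]] := first_branch xp x0.
  move: Mx; rewrite aE lez_nat => Ma.
  exists (a - M)%N => //; exists b.-1; first by rewrite /= ltn_predRL prednK.
  by exists (schneider x) => //; rewrite subnKC// prednK.
- by rewrite hausdorff_premeasure_set1// ltW.
- rewrite (eq_eseriesr (g := fun k =>
    (p.-1%:R * (p%:R^-1 `^ s) ^+ M * (p%:R^-1 `^ s) ^+ k)%:E)); last first.
    by move=> k _; rewrite powR_exprn// exprD mulrA.
  by apply: geometric_eseries_le; rewrite ?powR_ge0// mulr_ge0// exprn_ge0// powR_ge0.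
Qed.

Lemma eventually_large_digits_pZp M N :
  @eventually_large_digits R p p_pr M N `<=` @pZp R p p_pr.
Proof. by move=> x []. Qed.

(* For M large the contraction ratios of the branches with first digit at least
   M satisfy sum_k c_k^s < 1, while the premeasure of the set is finite. *)
Lemma hausdorff_measure_large_digits0 s : (0 < s)%R ->
  exists M, hausdorff_measure s (@eventually_large_digits R p p_pr M 0) = 0.
Proof.
move=> s0; have q1 : ((p%:R^-1 : R) `^ s < 1)%R by rewrite powR_lt1 ?pV_ge0.
have p10 : (0 < p.-1%:R :> R)%R by rewrite ltr0n ltn_predRL prime_gt1.
(* This choice makes (p - 1) q^M / (1 - q) < 1 for q = p^(-s). *)
have [||M qM] := @exprn_lt R (p%:R^-1 `^ s) ((1 - p%:R^-1 `^ s) / p.-1%:R).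
- by rewrite powR_ge0 q1.
- by rewrite divr_gt0// subr_gt0.
exists M; apply/hausdorff_measure0P => delta d0.
set D := eventually_large_digits M 0.
have hfin : hausdorff_premeasure s delta D \is a fin_num.
  rewrite ge0_fin_numE ?hausdorff_premeasure_ge0//.
  apply: le_lt_trans (hausdorff_premeasure_pZp_fin (ltW s0) d0).
  exact/le_hausdorff_premeasure/eventually_large_digits_pZp.
have Dsub x : D x -> pZp x /\
    (x = 0%R \/ (M%:Z <= first_a x)%R /\ D (schneider x)).
  move=> xD; split; first exact: eventually_large_digits_pZp xD.
  have [->|x0] := eqVneq x 0%R; [by left|right].
  case: (xD) => _ /(_ 0%N isT) [/= x0'|/= Mx]; first by rewrite x0' eqxx in x0.
  by split=> //; exact: eventually_large_digits0.
have := hausdorff_premeasure_branches s0 d0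
  (@eventually_large_digits_pZp M 0) hfin Dsub.
rewrite -(fineK hfin) -EFinM lee_fin => h.
have hD0 : (0 <= fine (hausdorff_premeasure s delta D))%R.
  exact/fine_ge0/hausdorff_premeasure_ge0.
(* A positive finite h cannot satisfy h <= theta h with theta < 1. *)
apply/eqP; rewrite eqe eq_le hD0 andbT leNgt; apply/negP => hD.
move: h; rewrite leNgt gtr_pMl// => /negP; apply.
by rewrite ltr_pdivrMr ?subr_gt0// mul1r mulrC -ltr_pdivlMr.
Qed.
(** One [M] serves every [N]: [schneider] sends the set for N + 1 into the set for N, so nullity is
    pulled back along the branches by induction. *)
Lemma hausdorff_measure_large_digits s : (0 < s)%R ->
  exists M, forall N, hausdorff_measure s (@eventually_large_digits R p p_pr M N) = 0.
Proof.
move=> s0; have [M M0] := hausdorff_measure_large_digits0 s0.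
exists M; elim=> [//|N /hausdorff_measure0P IH].
apply/hausdorff_measure0P => delta d0.
apply/eqP; rewrite eq_le hausdorff_premeasure_ge0 andbT.
(* The first digit is now free, hence the bound 0 on it; the finite factor multiplies a null
   premeasure. *)
rewrite -(mule0 (p.-1%:R * (p%:R^-1 `^ s) ^+ 0 / (1 - p%:R^-1 `^ s))%:E) -(IH _ d0).
apply: hausdorff_premeasure_branches => //.
- exact: eventually_large_digits_pZp.
- by rewrite IH.
- move=> x xD; split; first exact: eventually_large_digits_pZp xD.
  have [->|x0] := eqVneq x 0%R; [by left|right].
  split; last exact: eventually_large_digitsS.
  have [a [b [-> _ _ _]]] := first_branch (eventually_large_digits_pZp xD) x0.
  by rewrite lez_nat.
Qed.
End PadicHausdorff.

(** * Points of finite convergence exponent, and a lower bound for H^1 *)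

Section Digits.
Variables (R : realType) (p : nat) (p_pr : prime p).
Local Notation Z := (padic_int p_pr).
Local Notation Q := (padic R p_pr).
Implicit Types (x : Q) (y z : R).

Lemma iter_schneider_pZp n x : pZp x -> pZp (iter n (@schneider R p p_pr) x).
Proof. by case: n => // n _; rewrite iterS; exact: schneider_pZp. Qed.

(** For some s >= 0 the series converges, so its terms are eventually below (M + 1)^(-s), which
    excludes digits below M. If s = 0 every term is 1 and the expansion must stop. *)
Lemma conv_exponent_lty_large_digits M x : pZp x ->
  (conv_exponent x < +oo)%E -> exists N, eventually_large_digits M N x.
Proof.
move=> xp /ereal_inf_lt[_ [s [s0 sfin] <-] _].
(* Taking M + 1 keeps the base positive when M = 0. *)
pose c : R := M.+1%:R `^ (- s).
have c0 : 0 < c by rewrite powR_gt0.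
have [|N smallN] := nneseries_lty_small _ c0 sfin.
  by move=> n _; rewrite lee_fin powR_ge0.
exists N; split=> // n Nn.
have [->|xn0] := eqVneq (iter n (@schneider R p p_pr) x) 0; [by left|right].
have /= := smallN n.+1 (leqW Nn) xn0.
rewrite /digit_a /= lte_fin.
have [a [b [-> a0 _ _]]] := first_branch (iter_schneider_pZp n xp) xn0.
rewrite lez_nat leqNgt => ac; apply/negP => aM; move: ac.
apply/negP; rewrite -leNgt /c !powRN lef_pV2 ?posrE ?powR_gt0 ?ltr0n//.
by apply: ge0_ler_powR; rewrite ?nnegrE// ler_nat ltnW// ltnW.
Qed.

(** * Reversal of base p digits and positivity of H^1(p Z_p) *)

Let p_gt0 : (0 < p)%N. Proof. exact: prime_gt0. Qed.
Let pR_gt0 : 0 < p%:R :> R. Proof. by rewrite ltr0n. Qed.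

(* The integer part of p^n y, whose last digit in base p is the n-th digit of y
   after the radix point. *)
Definition prefix (y : R) (n : nat) : nat := Num.truncn (p%:R ^+ n * y).

Lemma prefix0 y : 0 <= y < 1 -> prefix y 0 = 0%N.
Proof. by move=> y01; apply: truncn_def; rewrite expr0 mul1r. Qed.

Lemma prefixS_div y n : 0 <= y -> (prefix y n.+1 %/ p)%N = prefix y n.
Proof.
move=> y0; rewrite /prefix; set t := Num.truncn (_ ^+ n * y).
have pny0 k : 0 <= p%:R ^+ k * y by rewrite mulr_ge0// exprn_ge0// ltW.
have /andP[t1 t2] := truncn_itv (pny0 n).
apply/eqP; rewrite eqn_leq -ltnS ltn_divLR// leq_divRL//.
rewrite truncn_ge_nat// truncn_lt_nat// !natrM exprS -mulrA !(mulrC _ p%:R).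
by rewrite ler_pM2l// ltr_pM2l// t1 t2.
Qed.

(** The numbers p^n y and p^n z have the same integer part, so they differ by less than 1. *)
Lemma prefix_close y z n : 0 <= y -> 0 <= z -> prefix y n = prefix z n ->
  `|y - z| <= p%:R ^- n.
Proof.
move=> y0 z0; rewrite /prefix => E.
have pn0 : 0 < p%:R ^+ n :> R by rewrite exprn_gt0.
have /andP[y1 y2] := truncn_itv (mulr_ge0 (ltW pn0) y0).
have /andP[z1 z2] := truncn_itv (mulr_ge0 (ltW pn0) z0).
rewrite -E -natr1 in z1 z2; rewrite -natr1 in y2.
rewrite -(ler_pM2l pn0) mulfV ?gt_eqF// -{1}(gtr0_norm pn0) -normrM mulrBr.
rewrite ler_norml; apply/andP; split; lra.
Qed.

(** If d_i is the i-th digit of y after the radix point, this is the sum of d_i p^(i-1) for 1 <= i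
    <= n, the residue modulo p^n of the reversed number. *)
Fixpoint reversed_digits (y : R) (n : nat) : nat :=
  if n is m.+1 then (reversed_digits y m + (prefix y m.+1 %% p) * p ^ m)%N else 0%N.

Lemma reversed_digits_lt y n : (reversed_digits y n < p ^ n)%N.
Proof.
elim: n => [|n IH] //=; rewrite expnS.
have := ltn_pmod (prefix y n.+1) p_gt0; move: (_ %% _)%N => d dp.
by rewrite (leq_trans (_ : _ < d.+1 * p ^ n)%N)// ?leq_mul2r ?dp ?orbT// mulSn ltn_add2r.
Qed.

Fact reversed_digits_subproof y n :
  reversed_digits y n = reversed_digits y n.+1 %[mod p ^ n].
Proof. by rewrite /= addnC modnMDl. Qed.

Definition padic_of_real (y : R) : Z :=
  mk_padic_int p_pr (reversed_digits_subproof y).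

Lemma residue_padic_of_real y n : padic_of_real y n = reversed_digits y n.
Proof. by rewrite /= modn_small// reversed_digits_lt. Qed.

(** Reduction modulo lower powers of p recovers the digits one by one. They rebuild the prefix from
    its start 0, where y < 1 enters. *)
Lemma reversed_digits_prefix y z n : 0 <= y < 1 -> 0 <= z < 1 ->
  reversed_digits y n = reversed_digits z n -> prefix y n = prefix z n.
Proof.
move=> y01 z01; elim: n => [_|n IH /= E]; first by rewrite !prefix0.
have [y0 _] := andP y01; have [z0 _] := andP z01.
have rE : reversed_digits y n = reversed_digits z n.
  move/(congr1 (modn^~ (p ^ n)%N)): E.
  by rewrite !(addnC _ (_ * _)%N) !modnMDl !modn_small ?reversed_digits_lt.
move/eqP: E; rewrite rE eqn_add2l eqn_pmul2r ?expn_gt0 ?p_gt0// => /eqP dE.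
by rewrite (divn_eq (prefix y n.+1) p) (divn_eq (prefix z n.+1) p) !prefixS_div// IH// dE.
Qed.

(** If the images are at distance p^(-m), their residues modulo p^m agree, so y and z share m digits
    and are within p^(-m). *)
Lemma padic_of_real_dist y z : 0 <= y < 1 -> 0 <= z < 1 ->
  `|y - z| <= padic_norm (of_padic_int R (padic_of_real y - padic_of_real z)).
Proof.
move=> y01 z01; have [y0 _] := andP y01; have [z0 _] := andP z01.
have close n : padic_of_real y n = padic_of_real z n -> `|y - z| <= p%:R ^- n.
  rewrite !residue_padic_of_real => /(reversed_digits_prefix y01 z01).
  exact: prefix_close.
set w := (padic_of_real y - padic_of_real z); have yE : padic_of_real y = padic_of_real z + w by rewrite addrC subrK.
have [w0|/padic_decomp[m [u [uU wE]]]] := eqVneq w 0.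
  (* Equal images share all digits, so |y - z| is at most every p^(-n). *)
  rewrite w0 rmorph0 padic_norm0 leNgt; apply/negP => yz.
  have [|n] := @exprn_lt R p%:R^-1 _ _ yz.
    by rewrite invr_ge0 ltW//= invf_lt1// ltr1n prime_gt1.
  by rewrite ltNge exprVn close// yE w0 addr0.
rewrite wE rmorphM rmorphXn rmorph_nat exprnP padic_normE// -exprnN.
apply: close; rewrite yE wE residueD residueM -natrX residue_nat modnn mul0n mod0n.
by rewrite addn0 residue_mod.
Qed.

(** The factor p moves the image from Z_p into p Z_p, at the price of the constant L = p for the
    inverse. *)
Lemma hausdorff_measure1_pZp : hausdorff_measure 1 (@pZp R p p_pr) != 0%E.
Proof.
apply: (hausdorff_measure1_neq0
  (f := fun y => p%:R * of_padic_int R (padic_of_real y) : Q) pR_gt0).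
  move=> _ [y _ <-]; exists (of_padic_int R (padic_of_real y)) => //.
  exact: padic_norm_int.
move=> y z /=; rewrite !in_itv/= => y01 z01.
rewrite /mdist/= /padic_dist -mulrBr -rmorphB padic_normM.
have := @padic_norm_pX R p p_pr 1; rewrite expr1 => ->.
by rewrite mulrA expr1 mulfV ?gt_eqF// mul1r padic_of_real_dist.
Qed.

End Digits.

(** * Dimensions of the exponent sets *)

Lemma hausdorff_measure_conv_exponent_lty (R : realType) (p : nat)
    (p_pr : prime p) (s : R) : 0 < s ->
  hausdorff_measure s
    [set x : padic R p_pr | pZp x /\ (conv_exponent x < +oo)%E] = 0%E.
Proof.
move=> /(hausdorff_measure_large_digits p_pr)[M M0].
apply: le_hausdorff_measure0 (hausdorff_measure0_bigcup M0).
by move=> x [xp /(conv_exponent_lty_large_digits M xp)[N xN]]; exists N.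
Qed.

Theorem theorem4 (R : realType) (p : nat) (p_pr : prime p) :
  hausdorff_dim (exponent_set p_pr (+oo%E : \bar R)) = 1%E /\
  (forall alpha : \bar R, (0 <= alpha)%E -> (alpha < +oo)%E ->
     hausdorff_dim (exponent_set p_pr alpha) = 0%E).
Proof.
split; last first.
  move=> alpha _ alphaoo; apply/eqP; rewrite eq_le hausdorff_dim_ge0 andbT.
  apply: hausdorff_dim_le => // s s0.
  apply: le_hausdorff_measure0 (hausdorff_measure_conv_exponent_lty p_pr s0).
  by move=> x [xp xa]; split=> //; rewrite xa.
apply/eqP; rewrite eq_le; apply/andP; split.
  apply: hausdorff_dim_le => // s s1.
  by apply: le_hausdorff_measure0 (hausdorff_measure_pZp p_pr s1) => x [].
(* If H^s(T(oo)) = 0 for some s < 1, then H^1(T(oo)) = 0, and p Z_p, the union of T(oo) and the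
   H^1-null set {tau < oo}, would be H^1-null. *)
apply: le_ereal_inf_tmp => _ [s [s0 Es] <-]; rewrite lee_fin leNgt.
apply/negP => s1; have /eqP := hausdorff_measure1_pZp R p_pr; apply.
have E1 : hausdorff_measure 1 (exponent_set p_pr (+oo%E : \bar R)) = 0%E.
  by apply: hausdorff_measure1_eq0 Es; rewrite s0 ltW.
have C1 := hausdorff_measure_conv_exponent_lty p_pr (@ltr01 R).
pose F n := if n is 0%N then exponent_set p_pr (+oo%E : \bar R)
  else [set x : padic R p_pr | pZp x /\ (conv_exponent x < +oo)%E].
apply: (le_hausdorff_measure0 (B := \bigcup_n F n)).
  move=> x xp; have [xoo|xoo] := eqVneq (conv_exponent x) +oo%E.
    by exists 0%N => //; split.
  by exists 1%N => //; split => //; rewrite ltey.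
by apply: hausdorff_measure0_bigcup => -[|n].
Qed.
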